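(* For $n\in\mathbf{N}\cup\{\infty\}$ let $\mathscr{M}_n=(\mathsf{M}_n,\tau_n,\mathfrak{m}_n)$ be a normalized bounded Lorentzian metric measure space. If $(\mathscr{M}_n)_{n\in\mathbf{N}}$ box-converges to $\mathscr{M}_\infty$, i.e. $\mathsf{L}\square(\mathscr{M}_n,\mathscr{M}_\infty)\to0$ as $n\to\infty$, then it converges to $\mathscr{M}_\infty$ in the distortion sense, i.e. $\mathsf{L}\mathbf{\Delta}_0(\mathscr{M}_n,\mathscr{M}_\infty)\to0$ as $n\to\infty$. In turn, if $(\mathscr{M}_n)_{n\in\mathbf{N}}$ converges to $\mathscr{M}_\infty$ in the distortion sense, then it converges intrinsically to $\mathscr{M}_\infty$.
   Context: A bounded Lorentzian metric space is a pair $(\mathsf{M},\tau)$ of a nonempty set $\mathsf{M}$ and a function $\tau\colon\mathsf{M}^2\to[0,\infty)$ such that: (a) $\tau(x,y)+\tau(y,z)\le\tau(x,z)$ whenever $\tau(x,y)>0$ and $\tau(y,z)>0$; (b) there is a topology $T$ on $\mathsf{M}$ such that $\tau$ is continuous for the product topology $T^2$ and $\{\tau\ge\varepsilon\}\subset\mathsf{M}^2$ is compact for every $\varepsilon>0$; (c) for all distinct $x,y\in\mathsf{M}$ there is $z\in\mathsf{M}$ with $\tau(x,z)\ne\tau(y,z)$ or $\tau(z,x)\neq\tau(z,y)$. All topological and Borel notions on $\mathsf{M}$ refer to the coarsest topology satisfying (b), which exists and is Polish. A normalized bounded Lorentzian metric measure space is a triple $\mathscr{M}=(\mathsf{M},\tau,\mathfrak{m})$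 with $(\mathsf{M},\tau)$ a bounded Lorentzian metric space and $\mathfrak{m}$ a Borel probability measure on $\mathsf{M}$ (not necessarily of full support). Intrinsic convergence. For $k\in\mathbf{N}$ let $\mathsf{T}^k\colon\mathsf{M}^k\to\mathbf{R}^{k\times k}$, $\mathsf{T}^k(x_1,\dots,x_k)_{ij}:=\tau(x_i,x_j)$, and $\bar{\mathfrak{m}}^k:=\mathsf{T}^k_\sharp\mathfrak{m}^{\otimes k}$ (push-forward). $(\mathscr{M}_n)_{n\in\mathbf{N}}$ converges intrinsically to $\mathscr{M}_\infty$ if for every $k\in\mathbf{N}$, $(\bar{\mathfrak{m}}_n^k)_{n\in\mathbf{N}}$ converges narrowly (i.e. tested against bounded continuous functions) to $\bar{\mathfrak{m}}_\infty^k$ in the space of Borel probability measures on $\mathbf{R}^{k\times k}$. Distortion distance. $\mathsf{L}\mathbf{\Delta}_0(\mathscr{M},\mathscr{M}'):=\inf_\pi\inf\{\varepsilon>0:\pi^{\otimes2}[\{(x,x',y,y')\in(\mathsf{M}\times\mathsf{M}')^2:|\tau(x,y)-\tau'(x',y')|>\varepsilon\}]\le\varepsilon\}$, where $\pi$ ranges over all couplings of $\mathfrak{m}$ and $\mathfrak{m}'$ (Borel probability measures on $\mathsf{M}\times\mathsf{M}'$ with marginals $\mathfrak{m},\mathfrak{m}'$). Box distance. For Borel measurable $u,v\colon[0,1]^2\to[0,\infty)$ let $\square(u,v)$ be the infimum of all $\varepsilon>0$ for which there is a Borel set $Q\subset[0,1]$ with $\mathscr{L}^1[Q]\le\varepsilon$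 and $|u-v|\le\varepsilon$ on $([0,1]\setminus Q)^2$, where $\mathscr{L}^1$ is Lebesgue measure. $\mathrm{Par}\,\mathscr{M}$ is the set of parametrizations of $\mathscr{M}$, i.e. Borel maps $\psi\colon[0,1]\to\mathsf{M}$ with $\psi_\sharp\mathscr{L}^1=\mathfrak{m}$; $\psi^*\tau(s,t):=\tau(\psi(s),\psi(t))$. Then $\mathsf{L}\square(\mathscr{M},\mathscr{M}'):=\inf\{\square(\psi^*\tau,\psi'^*\tau'):\psi\in\mathrm{Par}\,\mathscr{M},\ \psi'\in\mathrm{Par}\,\mathscr{M}'\}$. *)

(* Defs.v *)
From HB Require Import structures.
From mathcomp Require Import all_boot all_order all_algebra.
From mathcomp Require Import all_classical all_reals all_analysis.

Set Implicit Arguments.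
Unset Strict Implicit.
Unset Printing Implicit Defensive.

Import Order.TTheory GRing.Theory Num.Theory.
Import numFieldNormedType.Exports.

Local Open Scope classical_set_scope.
Local Open Scope ring_scope.

Record topology (T : Type) := Topology {
  opens : set (set T);
  opensT : opens setT;
  opensI : forall A B, opens A -> opens B -> opens (A `&` B);
  opens_bigcup : forall F : set (set T),
    F `<=` opens -> opens (\bigcup_(A in F) A) }.

Lemma topology_inj (T : Type) : injective (@opens T).
Proof.
move=> [A T1 I1 U1] [B T2 I2 U2] /= E; move: T1 I1 U1; rewrite E => T1 I1 U1.
by congr Topology; exact: Prop_irrelevance.
Qed.

(* Type alias carrying O as its canonical topology. *)
Definition space (T : pointedType) (O : topology T) : Type := T.

Section space_topology.
Context (T : pointedType) (O : topology T).

HB.instance Definition _ := Pointed.on (space O).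

Let opens_bigcupT (I : Type) (f : I -> set (space O)) :
  (forall i, opens O (f i)) -> opens O (\bigcup_i f i).
Proof.
move=> Of; rewrite (_ : \bigcup_i f i = \bigcup_(A in range f) A); last first.
  by rewrite bigcup_image.
by apply: opens_bigcup => _ [i _ <-].
Qed.

HB.instance Definition _ :=
  isOpenTopological.Build (space O) (@opensT _ O) (@opensI _ O) opens_bigcupT.

Lemma open_spaceE : @open (space O) = opens O.
Proof. by []. Qed.
End space_topology.

Notation borel T := (g_sigma_algebraType (@open T)).

Section lorentzian.
Context (R : realType) (M : pointedType) (tau : M -> M -> R).

Definition admissible (O : topology M) : Prop :=
  continuous (fun p : space O * space O => tau p.1 p.2) /\
  forall e : R, 0 < e -> compact [set p : space O * space O | e <= tau p.1 p.2].

Record bounded_lorentzian : Prop := BoundedLorentzian {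
  tau_ge0 : forall x y, 0 <= tau x y;
  reverse_triangle : forall x y z,
    0 < tau x y -> 0 < tau y z -> tau x y + tau y z <= tau x z;
  has_admissible : exists O : topology M, admissible O;
  distinguish : forall x y, x <> y ->
    exists z, tau x z <> tau y z \/ tau z x <> tau z y }.

(* A coarsest admissible topology, if there is one, is the intersection of all
   admissible topologies; that the intersection is admissible for a bounded
   Lorentzian metric space is coarsest_admissible below. *)
Definition coarsest_opens : set (set M) :=
  [set U | forall O : topology M, admissible O -> opens O U].

Let coarsestT : coarsest_opens setT.
Proof. by move=> O _; exact: opensT. Qed.

Let coarsestI A B :
  coarsest_opens A -> coarsest_opens B -> coarsest_opens (A `&` B).
Proof. by move=> oA oB O aO; apply: opensI; [exact: oA|exact: oB]. Qed.

Let coarsest_bigcup (F : set (set M)) :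
  F `<=` coarsest_opens -> coarsest_opens (\bigcup_(A in F) A).
Proof. by move=> FO O aO; apply: opens_bigcup => A /FO; exact. Qed.

Definition coarsest : topology M :=
  Topology coarsestT coarsestI coarsest_bigcup.

(* Topology of the metric
     max (sup_z |tau x z - tau y z|) (sup_z |tau z x - tau z y|),
   which turns out to be the coarsest admissible one. *)
Section ball_topology.
Hypothesis tau0 : forall x y, 0 <= tau x y.

Definition tau_ball (x : M) (e : R) : set M := [set y | exists2 d, d < e &
  forall z, `|tau x z - tau y z| <= d /\ `|tau z x - tau z y| <= d].

Let ball_opens : set (set M) :=
  [set U | forall x, U x -> exists2 e, 0 < e & tau_ball x e `<=` U].

Let ballsT : ball_opens setT.
Proof. by move=> x _; exists 1. Qed.

Let tau_ball_le x e e' : e <= e' -> tau_ball x e `<=` tau_ball x e'.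
Proof. by move=> ee' y [d de dxy]; exists d => //; exact: lt_le_trans ee'. Qed.

Let ballsI A B : ball_opens A -> ball_opens B -> ball_opens (A `&` B).
Proof.
move=> oA oB x [/oA[e e0 eA] /oB[e' e'0 eB]].
exists (Num.min e e'); first by rewrite lt_min e0.
move=> y yx; split.
  by apply: eA; apply: tau_ball_le yx; rewrite ge_min lexx.
by apply: eB; apply: tau_ball_le yx; rewrite ge_min lexx orbT.
Qed.

Let balls_bigcup (F : set (set M)) :
  F `<=` ball_opens -> ball_opens (\bigcup_(A in F) A).
Proof.
move=> FO x [A FA Ax]; have [e e0 eA] := FO _ FA _ Ax.
by exists e => // y /eA Ay; exists A.
Qed.

Definition ball_topology : topology M := Topology ballsT ballsI balls_bigcup.

Let open_tau_ball x e : opens ball_topology (tau_ball x e).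
Proof.
move=> y [d de dxy]; exists (e - d); first by rewrite subr_gt0.
move=> y' [d' d'e dyy']; exists (d + d'); first by rewrite addrC -ltrBrDr.
move=> z; have [a b] := dxy z; have [a' b'] := dyy' z.
split; [apply: le_trans (lerD a a')|apply: le_trans (lerD b b')].
  by apply: le_trans (ler_normD _ _); rewrite addrA subrK.
by apply: le_trans (ler_normD _ _); rewrite addrA subrK.
Qed.

Let tau_ballxx x e : 0 < e -> tau_ball x e x.
Proof. by move=> e0; exists 0 => // z; rewrite !subrr normr0. Qed.

Let nbhs_tau_ball (x : space ball_topology) e : 0 < e -> nbhs x (tau_ball x e).
Proof.
move=> e0; apply: (@open_nbhs_nbhs (space ball_topology)).
by split; [exact: open_tau_ball|exact: tau_ballxx].
Qed.

Lemma tau_ball_nbhs (O : topology M) : admissible O ->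
  forall (x : space O) e, 0 < e -> nbhs x (tau_ball x e).
Proof.
move=> [ctau cpt] x e e0; set d := e / 2.
have d0 : 0 < d by rewrite divr_gt0.
have ctau2 (f g : space O * space O -> space O)
    (p : space O * space O) (a b : space O) :
    f @ p --> a -> g @ p --> b -> (fun q => tau (f q) (g q)) @ p --> tau a b.
  move=> fa gb.
  exact: (@continuous2_cvg _ (space O) (space O) R _ _ f g tau a b (ctau (a, b))).
have K2 : compact [set p.2 | p in [set p : space O * space O | d <= tau p.1 p.2]].
  apply: continuous_compact (cpt _ d0).
  by apply: continuous_subspaceT => -[a b] /=; exact: cvg_snd.
have K1 : compact [set p.1 | p in [set p : space O * space O | d <= tau p.1 p.2]].
  apply: continuous_compact (cpt _ d0).
  by apply: continuous_subspaceT => -[a b] /=; exact: cvg_fst.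
have small a b : 0 <= a < d -> 0 <= b < d -> `|a - b| <= d.
  move=> /andP[a0 ad] /andP[b0 bd]; rewrite ler_norml; apply/andP; split.
    by rewrite lerBrDr addrC (le_trans _ a0)// subr_le0 ltW.
  by rewrite lerBlDr (le_trans (ltW ad))// lerDl.
have de : d < e by rewrite /d ltr_pdivrMr// ltr_pMr// ltr1n.
have near2 : \forall x' \near x, forall z,
    [set p.2 | p in [set p : space O * space O | d <= tau p.1 p.2]] z ->
    `|tau x z - tau x' z| <= d.
  apply: (iffLR (compact_near_coveringP _) K2 _ (nbhs x)) => z _.
  have h1 : (fun p : space O * space O => tau x p.1 - tau p.2 p.1) @ (z, x)
      --> tau x z - tau x z.
    apply: cvgB.
      apply: ctau2; [exact: cvg_cst|exact: cvg_fst].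
    apply: ctau2; [exact: cvg_snd|exact: cvg_fst].
  rewrite subrr in h1.
  have /cvgr0_norm_le/(_ _ d0) := h1.
  exact.
have near1 : \forall x' \near x, forall z,
    [set p.1 | p in [set p : space O * space O | d <= tau p.1 p.2]] z ->
    `|tau z x - tau z x'| <= d.
  apply: (iffLR (compact_near_coveringP _) K1 _ (nbhs x)) => z _.
  have h1 : (fun p : space O * space O => tau p.1 x - tau p.1 p.2) @ (z, x)
      --> tau z x - tau z x.
    apply: cvgB.
      apply: ctau2; [exact: cvg_fst|exact: cvg_cst].
    apply: ctau2; [exact: cvg_fst|exact: cvg_snd].
  rewrite subrr in h1.
  have /cvgr0_norm_le/(_ _ d0) := h1.
  exact.
apply: filterS2 near1 near2 => x' n1 n2; exists d => // z; split.
  have [|h] := pselect ([set p.2 | p in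
    [set p : space O * space O | d <= tau p.1 p.2]] z); first exact: n2.
  by apply: small; rewrite tau0/= ltNge; apply/negP => ?; apply: h;
    [exists (x, z)|exists (x', z)].
have [|h] := pselect ([set p.1 | p in
    [set p : space O * space O | d <= tau p.1 p.2]] z); first exact: n1.
by apply: small; rewrite tau0/= ltNge; apply/negP => ?; apply: h;
    [exists (z, x)|exists (z, x')].
Qed.

Lemma ball_topology_coarse (O : topology M) :
  admissible O -> opens ball_topology `<=` opens O.
Proof.
move=> aO U oU; rewrite -open_spaceE openE => x /oU[e e0 eU].
exact: filterS eU (tau_ball_nbhs aO _ e0).
Qed.

Lemma ball_topology_admissible :
  (exists O : topology M, admissible O) -> admissible ball_topology.
Proof.
case=> O aO; split=> [[x y]|e e0].
  apply/cvgrPdist_le => /= e e0.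
  have e20 : 0 < e / 2 by rewrite divr_gt0.
  exists (tau_ball x (e / 2), tau_ball y (e / 2)) => /=.
    by split; exact: nbhs_tau_ball.
  move=> [x' y'] /= [[d de xx'] [d' d'e yy']].
  have [a _] := xx' y; have [_ b] := yy' x'.
  rewrite (splitr e); apply: le_trans (lerD (ltW de) (ltW d'e)).
  apply: le_trans (lerD a b); apply: le_trans (ler_normD _ _).
  by rewrite addrA subrK.
have idc : continuous (id : space O -> space ball_topology).
  apply/continuousP => A oA; rewrite preimage_id open_spaceE.
  exact: ball_topology_coarse.
have := @continuous_compact (space O * space O)%type
  (space ball_topology * space ball_topology)%type
  (fun p => (p.1 : space ball_topology, p.2 : space ball_topology)) _ _ (aO.2 _ e0).
rewrite (_ : _ @` _ =
  [set p : space ball_topology * space ball_topology | e <= tau p.1 p.2]).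
  apply; apply: continuous_subspaceT => -[a b] A [[U V] /= [Ua Vb] UVA].
  exists (U, V) => /=; first by split; [exact: (idc a)|exact: (idc b)].
  by move=> [c d] /= ?; apply: UVA.
by apply/seteqP; split=> [_ [[a b]/= h <-]//|[a b] h]; exists (a, b).
Qed.

End ball_topology.

Lemma coarsest_admissible : bounded_lorentzian -> admissible coarsest.
Proof.
move=> [t0 _ exO _]; have aB := ball_topology_admissible t0 exO.
suff -> : coarsest = ball_topology by [].
apply: topology_inj; apply/seteqP; split=> [U|U oU O aO]; first exact.
exact: ball_topology_coarse aO _ oU.
Qed.

End lorentzian.

(* Nonemptiness of the underlying set is part of pointedType. *)
Record lmmspace (R : realType) := LMMSpace {
  carrier : pointedType;
  tau : carrier -> carrier -> R;
  tauP : bounded_lorentzian tau;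
  mm : probability (borel (space (coarsest tau))) R }.

Notation points X := (space (coarsest (@tau _ X))).

Section distortion.
Context (R : realType) (X Y : lmmspace R).

Definition coupling : set (probability (borel (points X * points Y)%type) R) :=
  [set pi |
    (forall A : set (borel (points X)), measurable A ->
       pushforward pi (fst : _ -> borel (points X)) A = mm X A) /\
    (forall B : set (borel (points Y)), measurable B ->
       pushforward pi (snd : _ -> borel (points Y)) B = mm Y B)].

Definition distortion : \bar R :=
  ereal_inf [set ereal_inf [set e%:E | e in [set e : R | 0 < e /\
      ((pi \x pi) [set p | (e < `|tau p.1.1 p.2.1 - tau p.1.2 p.2.2|)%R]
        <= e%:E)%E]]
    | pi in coupling].

End distortion.

Section box.
Context (R : realType).

Definition unit_itv : set (measurableTypeR R) := `[0, 1 : R]%classic.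

Definition box (u v : R -> R -> R) : \bar R :=
  ereal_inf [set e%:E | e in [set e : R | 0 < e /\
    exists Q : set (measurableTypeR R), [/\ measurable Q, Q `<=` unit_itv,
      (lebesgue_measure Q <= e%:E)%E &
      forall s t, (unit_itv `\` Q) s -> (unit_itv `\` Q) t ->
        `|u s t - v s t| <= e]]].

(* Borel maps on [0, 1] are represented by functions on the whole real line,
   whose values outside [0, 1] are never used. *)
Definition parametrization (X : lmmspace R) :
    set (measurableTypeR R -> borel (points X)) :=
  [set psi | measurable_fun unit_itv psi /\
    forall A, measurable A ->
      lebesgue_measure (unit_itv `&` psi @^-1` A) = mm X A].

Definition box_distance (X Y : lmmspace R) : \bar R :=
  ereal_inf [set b | exists psi psi', [/\ @parametrization X psi,
    @parametrization Y psi' &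
    b = box (fun s t => tau (psi s) (psi t))
            (fun s t => tau (psi' s) (psi' t))]].

End box.

(* k-fold product measure on the product sigma-algebra of k-tuples. *)
Fixpoint mpower d (T : measurableType d) (R : realType) (m : set T -> \bar R)
    (k : nat) : set (k.-tuple T) -> \bar R :=
  match k with
  | 0 => dirac [tuple]
  | k'.+1 => pushforward (m \x mpower m (k := k'))%E
      (fun p : T * k'.-tuple T => [tuple of p.1 :: p.2])
  end.

Section intrinsic.
Context (R : realType).

Definition tau_matrix (X : lmmspace R) (k : nat)
    (x : k.-tuple (borel (points X))) : borel 'M[R]_k :=
  \matrix_(i, j) tau (tnth x i) (tnth x j).

Definition matrix_law (X : lmmspace R) (k : nat) : set (borel 'M[R]_k) -> \bar R :=
  pushforward (mpower (mm X) (k := k)) (@tau_matrix X k).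

Definition narrow_cvg (T : ptopologicalType)
    (mu_ : nat -> set (borel T) -> \bar R) (mu : set (borel T) -> \bar R) : Prop :=
  forall f : T -> R, continuous f -> [bounded f x | x in setT] ->
    (\int[mu_ n]_x (f x)%:E)%E @[n --> \oo] --> (\int[mu]_x (f x)%:E)%E.

Definition intrinsic_cvg (X_ : nat -> lmmspace R) (X : lmmspace R) : Prop :=
  forall k, narrow_cvg (fun n => @matrix_law (X_ n) k) (@matrix_law X k).
End intrinsic.

(* Main.v *)
(** A parametrization pair pushes Lebesgue measure forward to a coupling [pi]; if
    the two pulled back time separations are [e]-close off [Q], then the distortion
    of [pi] exceeds [e] only on a subset of the union of two strips of mass
    [L(Q) <= e], hence with probability at most [2 e].  Conversely, for a coupling
    [pi] of distortion at most [e], the law [pi^k] realises both random matrices on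
    one space; for [i <> j] the pair [(z_i, z_j)] has law [pi x pi], and diagonal
    entries vanish by the reverse triangle inequality, so outside an event of
    probability [k^2 e] the two matrices differ entrywise by at most [e].
    Two measurability facts carry the weight: the space is the union of countably
    many compact sets and at most one further point, hence second countable, so that
    pairs of Borel maps are Borel; and [tau] is measurable for the product sigma
    algebra because the superlevel sets are compact. *)
From HB Require Import structures.
Require Import Defs.
From mathcomp Require Import finmap.
From mathcomp Require Import all_boot all_order all_algebra.
From mathcomp Require Import all_classical all_reals all_analysis.
From mathcomp Require Import measurable_realfun lra.
Import numFieldNormedType.Exports.
Import Order.TTheory GRing.Theory Num.Theory.

Set Implicit Arguments.
Unset Strict Implicit.
Unset Printing Implicit Defensive.

Local Open Scope classical_set_scope.
Local Open Scope ring_scope.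

HB.instance Definition _ (S T : ptopologicalType) := Pointed.on (S * T)%type.

Lemma lorentzian_xx (R : realType) (M : pointedType) (tau : M -> M -> R) x :
  bounded_lorentzian tau -> tau x x = 0.
Proof.
move=> h; apply/eqP; rewrite eq_le (tau_ge0 h) andbT leNgt; apply/negP => t0.
have := reverse_triangle h t0 t0.
by rewrite gerDl leNgt t0.
Qed.

(** * Borel structure of the coarsest admissible topology *)

Section coarsest_topology.
Context (R : realType) (M : pointedType) (tau : M -> M -> R).
Hypothesis tauP : bounded_lorentzian tau.

Local Notation PM := (Defs.space (coarsest tau)).

Let adm : admissible tau (coarsest tau) := coarsest_admissible tauP.

(** Open in the coarsest topology means open in every admissible one, in particular in
    [ball_topology]. *)
Lemma coarsest_open_ball (U : set PM) x : open U -> U x ->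
  exists2 e : R, 0 < e & tau_ball tau x e `<=` U.
Proof.
move=> oU Ux.
have aB := ball_topology_admissible (tau_ge0 tauP) (has_admissible tauP).
exact: (oU _ aB).
Qed.

Let large (e : R) : set (PM * PM) := [set p | e <= tau p.1 p.2].

(** The basis consists of interiors of balls of radius [r m] centred at finite nets of the compact
    sets [K n], and of those centred at the one point that may lie outside every [K n]. *)
Lemma second_countable_coarsest : exists B : nat -> set PM,
  (forall i, open (B i)) /\
  forall (U : set PM) x, open U -> U x -> exists i, B i x /\ B i `<=` U.
Proof.
have [ctau cpt] := adm.
pose r n : R := n.+1%:R^-1.
have r0 n : 0 < r n by rewrite invr_gt0.
pose b (x : PM) n : set PM := interior (tau_ball tau x (r n) : set PM).
have bx x n : b x n x by exact: tau_ball_nbhs (tau_ge0 tauP) _ adm _ _ (r0 n).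
have ob x n : open (b x n) by exact: open_interior.
pose K n : set PM := (fst @` large (r n)) `|` (snd @` large (r n)).
have cK n : compact (K n).
  apply: compactU; apply: continuous_compact (cpt _ (r0 n)).
    by apply: continuous_subspaceT => -[a c]; exact: cvg_fst.
  by apply: continuous_subspaceT => -[a c]; exact: cvg_snd.
have fcov n m : exists s : seq PM, forall x, K n x -> exists2 c, c \in s & b c m x.
  have := cK n; rewrite compact_cover => /(_ _ setT (fun c => b c m)).
  case=> [//|x _|D _ Dcov]; first by exists x.
  by exists (enum_fset D) => x /Dcov[c cD bc]; exists c.
have [s sP] := choice (fun p : nat * nat => fcov p.1 p.2).
(* A point outside every [K n] has [tau] zero to and from all points, so two such points coincide by
   [distinguish]. If there is none, any [z] will do. *)
have [z zP] : exists z : PM, forall x, (forall n, ~ K n x) -> x = z.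
  have [[z zK]|nz] := pselect (exists z : PM, forall n, ~ K n z); last first.
    by exists point => x xK; exfalso; apply: nz; exists x.
  exists z => x xK; apply: contrapT => xz.
  have null y : (forall n, ~ K n y) -> forall w, tau y w = 0 /\ tau w y = 0.
    move=> yK w; split; apply/eqP; rewrite eq_le (tau_ge0 tauP) andbT leNgt;
      apply/negP => /ltr_add_invr[n]; rewrite add0r => /ltW rn; apply: (yK n).
      by left; exists (y, w).
    by right; exists (w, y).
  have [w] := distinguish tauP xz.
  by have [-> ->] := null _ xK w; have [-> ->] := null _ zK w; case.
(* The index [(n, m, l)] selects the [l]-th net point of [K n] at scale [r m]. The default value of
   [nth] supplies the neighbourhoods of [z] when [l] is out of range. *)
pose B (q : nat * nat * nat) : set PM := b (nth z (s (q.1.1, q.1.2)) q.2) q.1.2.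
pose B' i := if unpickle i is Some q then B q else setT.
exists B'; split=> [i|U x oU Ux].
  by rewrite /B'; case: unpickle => [q|]; [exact: ob|exact: openT].
have [e e0 eU] := coarsest_open_ball oU Ux.
(* The basis set will be centred at a net point and not at [x]: two distances below [e / 2] add up
   to less than [e]. *)
have [m rm] : exists m, r m < e / 2.
  have /ltr_add_invr[m] : 0 < e / 2 by rewrite divr_gt0.
  by rewrite add0r => ?; exists m.
have sub c : b c m x -> b c m `<=` U.
  move=> /interior_subset[d1 d1m cx] y /interior_subset[d2 d2m cy].
  apply: eU; exists (d1 + d2).
    by rewrite (splitr e) ltrD// (lt_trans _ rm).
  move=> w; have [c1 c2] := cx w; have [c3 c4] := cy w.
  split; [apply: le_trans (lerD c1 c3)|apply: le_trans (lerD c2 c4)].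
    by rewrite [in leRHS]distrC; apply: le_trans (ler_normD _ _); rewrite addrA subrK.
  by rewrite [in leRHS]distrC; apply: le_trans (ler_normD _ _); rewrite addrA subrK.
suff [q Bq] : exists q, B q x /\ q.1.2 = m.
  exists (pickle q); rewrite /B' pickleK; case: Bq => Bq qm; split => //.
  by move: Bq; rewrite /B qm; exact: sub.
have [[n Kx]|nK] := pselect (exists n, K n x).
  have [c cs bc] := sP (n, m) _ Kx.
  exists (n, m, index c (s (n, m))); split => //.
  by rewrite /B /= nth_index.
have -> : x = z by apply: zP => n Kx; apply: nK; exists n.
exists (0%N, m, size (s (0%N, m))); split => //.
by rewrite /B /= nth_default.
Qed.

(* Each [tau >= e + 1/n] is compact, hence covered by finitely many open
   rectangles contained in [tau > e]. *)
Lemma measurable_tau :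
  measurable_fun setT (fun p : borel PM * borel PM => tau p.1 p.2).
Proof.
have [ctau cpt] := adm.
apply: (measurability _ (RGenOInfty.measurableE R)) => //.
move=> _ [_ [e ->] <-]; rewrite setTI.
have [e0|e0] := leP 0 e; last first.
  rewrite (_ : _ @^-1` _ = setT); first exact: measurableT.
  apply/seteqP; split=> // p _ /=; rewrite in_itv/= andbT.
  exact: lt_le_trans (tau_ge0 tauP _ _).
pose W : set (PM * PM) := [set p | e < tau p.1 p.2].
rewrite (_ : _ @^-1` _ = W); last first.
  by apply/seteqP; split => p; rewrite /W/= in_itv/= andbT.
have oW : open W.
  have /continuousP/(_ [set y | e < y]) := ctau.
  by apply; exact: open_gt.
(* The shift keeps the levels positive when [e] is [0]; only positive levels have compact superlevel
   sets. *)
pose r n : R := e + n.+1%:R^-1.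
have r0 n : 0 < r n by rewrite ltr_wpDl// invr_gt0.
have WE : W = \bigcup_n large (r n).
  apply/seteqP; split=> [p|p [n _]]; rewrite /W/=.
    by move=> /ltr_add_invr[n rn]; exists n => //; exact: ltW.
  by apply: lt_le_trans; rewrite ltrDl invr_gt0.
have mrect n : exists V : set (borel PM * borel PM),
    [/\ measurable V, large (r n) `<=` V & V `<=` W].
  have : @cover_compact (PM * PM)%type (large (r n)).
    by rewrite -compact_cover; exact: cpt.
  pose I := (set PM * set PM)%type.
  case/(_ I [set q | open q.1 /\ open q.2 /\ q.1 `*` q.2 `<=` W]
    (fun q => q.1 `*` q.2)) => [|p lp|D DI Dcov].
  - move=> [A B] /= [u1 [u2 _]]; rewrite openE => p [Ap Bp].
    by exists (A, B) => //=; split; exact: open_nbhs_nbhs.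
  - have : W p by rewrite WE; exists n.
    move: oW; rewrite openE => /[apply] -[[A B] /= [nA nB] ABW].
    exists (interior A, interior B) => /=.
      split; [exact: open_interior|split; [exact: open_interior|]].
      move=> q [qA qB]; apply: ABW; split; exact: interior_subset.
    by [].
  - exists (\bigcup_(q in [set` D]) (q.1 `*` q.2)); split => //.
      apply: fin_bigcup_measurable => // q /= /DI; rewrite inE => -[u1 [u2 _]].
      by apply: measurableX; exact: sub_sigma_algebra.
    by move=> p [q /= /DI]; rewrite inE => -[_ [_]]; exact.
have [V VP] := choice mrect.
rewrite (_ : W = \bigcup_n V n).
  by apply: bigcupT_measurable => n; case: (VP n).
rewrite WE; apply/seteqP; split=> [p [n _ lp]|p [n _ Vp]].
  by exists n => //; case: (VP n) => _ + _; exact.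
by rewrite -WE; case: (VP n) => _ _; exact.
Qed.

End coarsest_topology.

(** * Borel maps between topological spaces *)

Lemma continuous_borel_measurable (S T : ptopologicalType) (f : S -> T) :
  continuous f -> measurable_fun setT (f : borel S -> borel T).
Proof.
move=> /continuousP cf.
apply: (@measurability _ _ (borel S) (borel T) _ _ (@open T)) => //.
by move=> _ [U oU <-]; rewrite setTI; apply: sub_sigma_algebra; exact: cf.
Qed.

Lemma continuous_real_measurable (R : realType) (S : ptopologicalType)
    (f : S -> R) :
  continuous f -> measurable_fun setT (f : borel S -> R).
Proof.
move=> /continuousP cf.
apply: (measurability _ (RGenOInfty.measurableE R)) => //.
move=> _ [_ [e ->] <-]; rewrite setTI; apply: sub_sigma_algebra; apply: cf.
exact: interval_open.
Qed.

(* One second countable factor suffices: an open [W] is the union over the basis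
   of [B i `*` V i], with [V i] the largest open set such that
   [B i `*` V i `<=` W]. *)
Lemma measurable_pair_borel (d : measure_display) (Z : measurableType d)
    (S T : ptopologicalType) (B : nat -> set S) (f : Z -> S) (g : Z -> T) :
  (forall i, open (B i)) ->
  (forall (U : set S) x, open U -> U x -> exists i, B i x /\ B i `<=` U) ->
  measurable_fun setT (f : Z -> borel S) ->
  measurable_fun setT (g : Z -> borel T) ->
  measurable_fun setT (fun z => (f z, g z) : borel (S * T)%type).
Proof.
move=> oB bB mf mg.
apply: (@measurability _ _ _ (borel (S * T)%type) _ _ (@open (S * T)%type)) => //.
move=> _ [W oW <-]; rewrite setTI.
pose V i : set T := \bigcup_(U in [set U | open U /\ B i `*` U `<=` W]) U.
have oV i : open (V i) by apply: bigcup_open => U [].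
have -> : (fun z => (f z, g z)) @^-1` W =
    \bigcup_i (f @^-1` B i `&` g @^-1` V i).
  apply/seteqP; split=> [z Wz|z [i _ [Bz [U [oU UW] Uz]]]]; last exact: UW.
  have [[P Q] /= [nP nQ] PQW] : nbhs (f z, g z) W by exact: open_nbhs_nbhs.
  have [i [Bz BP]] := bB _ _ (open_interior P) nP.
  exists i => //; split => //; exists (interior Q) => //; split.
    exact: open_interior.
  move=> [s t] [/= Bs Qt]; apply: PQW; split => /=; last exact: interior_subset.
  by apply: interior_subset; exact: BP.
apply: bigcupT_measurable => i; apply: measurableI;
  rewrite -[X in measurable X]setTI.
  by apply: mf => //; exact: sub_sigma_algebra.
by apply: mg => //; exact: sub_sigma_algebra.
Qed.

(** * Push-forwards, products and finite powers of probability measures *)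

Definition mfun_of (d1 d2 : measure_display) (T1 : measurableType d1)
    (T2 : measurableType d2) (f : T1 -> T2)
    (mf : measurable_fun [set: T1] f) : {mfun T1 >-> T2} :=
  HB.pack f (isMeasurableFun.Build _ _ _ _ f mf).

Definition push (d1 d2 : measure_display) (T1 : measurableType d1)
    (T2 : measurableType d2) (R : realType) (P : probability T1 R)
    (f : T1 -> T2) (mf : measurable_fun [set: T1] f) : probability T2 R :=
  distribution P (mfun_of mf).

Section mpower_probability.
Context (d : measure_display) (T : measurableType d) (R : realType).
Variable P : probability T R.

Lemma measurable_tuple_cons k : measurable_fun
  [set: T * k.-tuple T] (fun p => [tuple of p.1 :: p.2]).
Proof.
exact: (@measurable_cons _ _ _ _ (fst : T * k.-tuple T -> T) _ snd).
Qed.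

(** The recursion of [mpower], with the probability structure carried along so that product measures
    can be formed and integrated at each stage. *)
Fixpoint mpower_prob k : probability (k.-tuple T) R :=
  match k with
  | 0 => (\d_[tuple] : probability (0.-tuple T) R)
  | k'.+1 => push (P \x mpower_prob k')%E (measurable_tuple_cons (k := k'))
  end.

Lemma mpower_probE k : mpower P (k := k) = mpower_prob k.
Proof. by elim: k => //= k ->. Qed.

(** Conditioning on the first coordinate drives the inductions on [k] below. It holds for every set
    [A], since the product measure is defined by integrating sections. *)
Lemma mpower_probS k (A : set (k.+1.-tuple T)) :
  mpower_prob k.+1 A =
  (\int[P]_x mpower_prob k ([set t : k.-tuple T | A [tuple of x :: t]]))%E.
Proof.
apply: eq_integral => x _ /=; congr (mpower_prob k _).
by apply/seteqP; split=> t; rewrite /xsection /= inE.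
Qed.

Lemma mpower_prob_tnth k (i : 'I_k) (A : set T) : measurable A ->
  mpower_prob k [set t | A (tnth t i)] = P A.
Proof.
move=> mA; elim: k i => [[]//|k IH] i; rewrite mpower_probS.
have [j ->|->] := unliftP ord0 i; last first.
  rewrite (eq_integral (fun x => (\1_A x)%:E)) => [|x _].
    by rewrite integral_indic// setIT.
  have [Ax|Ax] := pselect (A x).
    rewrite indicE mem_set//= -(probability_setT (mpower_prob k)).
    by congr (mpower_prob k _); apply/seteqP; split.
  transitivity (mpower_prob k set0); last by rewrite measure0 indicE memNset.
  by congr (mpower_prob k _); apply/seteqP; split.
rewrite (eq_integral (cst (P A))) => [|x _].
  by rewrite integral_cst// [X in (_ * X)%E]probability_setT mule1.
rewrite -(IH j); congr (mpower_prob k _).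
by apply/seteqP; split => t /=; rewrite tnthS.
Qed.

(** Exchange of the order of integration: both sides agree on rectangles. *)
Lemma product_measure12 (d' : measure_display) (T' : measurableType d')
    (Q : probability T' R) (A : set (T * T')) : measurable A ->
  (P \x Q)%E A = (P \x^ Q)%E A.
Proof.
move=> mA; apply: product_measure_unique => //= B C mB mC.
by rewrite product_measure2E.
Qed.

(** Distinct coordinates are independent. If one index is [0], integrating over the first coordinate
    leaves a one-coordinate law of a section of [E]; otherwise the integrand is constant by
    induction. *)
Lemma mpower_prob_tnth2 k (i j : 'I_k) (E : set (T * T)) : measurable E ->
  i != j -> mpower_prob k [set t | E (tnth t i, tnth t j)] = (P \x P)%E E.
Proof.
move=> mE; elim: k i j => [[]//|k IH] i j; rewrite mpower_probS.
have [i' ->|->] := unliftP ord0 i; have [j' ->|->] := unliftP ord0 j; last first.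
- by rewrite eqxx.
- move=> _; apply: eq_integral => x _.
  rewrite /= -(mpower_prob_tnth j') //; last exact: measurable_xsection.
  congr (mpower_prob k _); apply/seteqP; split => t /=;
    by rewrite tnth0 tnthS /xsection /= inE.
(* Here the first coordinate of the tuple is the second argument of [E], so the product has to be
   integrated in the other order. *)
- move=> _; rewrite product_measure12//; apply: eq_integral => x _.
  rewrite /= -(mpower_prob_tnth i') //; last exact: measurable_ysection.
  congr (mpower_prob k _); apply/seteqP; split => t /=;
    by rewrite tnth0 tnthS /ysection /= inE.
- move=> ij; have {}ij : i' != j' by apply: contraNneq ij => ->.
  rewrite (eq_integral (cst ((P \x P)%E E))) => [|x _].
    by rewrite integral_cst// [X in (_ * X)%E]probability_setT mule1.
  rewrite -(IH i' j')//; congr (mpower_prob k _).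
  by apply/seteqP; split => t /=; rewrite !tnthS.
Qed.

Lemma measurable_map_tuple (d' : measure_display) (T' : measurableType d')
    (f : T -> T') k : measurable_fun setT f ->
  measurable_fun setT (fun t : k.-tuple T => map_tuple f t).
Proof.
move=> mf; apply/measurable_fun_tnthP => i.
rewrite (_ : _ \o _ = fun t => f (tnth t i)).
  by apply: measurableT_comp => //; exact: measurable_tnth.
by apply/funext => t /=; rewrite tnth_map.
Qed.

End mpower_probability.

(** Powers commute with push-forward: induction treats the sections, and a change of variables along
    [f] treats the first coordinate. *)
Lemma mpower_prob_map (d d' : measure_display) (T : measurableType d)
    (T' : measurableType d') (R : realType) (P : probability T R)
    (Q : probability T' R) (f : T -> T') k (A : set (k.-tuple T')) :
  measurable_fun setT f ->
  (forall B, measurable B -> P (f @^-1` B) = Q B) -> measurable A ->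
  mpower_prob P k ((fun t => map_tuple f t) @^-1` A) = mpower_prob Q k A.
Proof.
move=> mf PQ; elim: k A => [|k IH] A mA.
  rewrite /= !diracE (_ : ([tuple] \in _ @^-1` A) = ([tuple] \in A))//.
  by apply/idP/idP; rewrite !inE/=; congr A; exact: val_inj.
have mA' : measurable ((fun p : T' * k.-tuple T' => [tuple of p.1 :: p.2]) @^-1` A).
  by rewrite -[X in measurable X]setTI; apply: measurable_tuple_cons.
rewrite !mpower_probS.
pose g : T' -> \bar R := fun y =>
  mpower_prob Q k [set t : k.-tuple T' | A [tuple of y :: t]].
have gE : g = mpower_prob Q k \o
    xsection ((fun p : T' * k.-tuple T' => [tuple of p.1 :: p.2]) @^-1` A).
  apply/funext => y; congr (mpower_prob Q k _).
  by apply/seteqP; split=> t; rewrite /xsection /= inE.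
have mg : measurable_fun setT g by rewrite gE; exact: measurable_fun_xsection.
transitivity (\int[P]_x g (f x))%E.
  apply: eq_integral => x _; rewrite /g -IH.
    congr (mpower_prob P k _); apply/seteqP; split => t /=; congr A; exact: val_inj.
  have := measurable_xsection (f x) mA'.
  by congr measurable; apply/seteqP; split=> t; rewrite /xsection /= inE.
rewrite -(@ge0_integral_pushforward _ _ _ _ _ f mf P setT g)//.
apply: eq_measure_integral => B mB _; exact: PQ.
Qed.

(** Both sides are measures in [A] with the same values on rectangles. *)
Lemma product_measure_push (R : realType) (d1 d2 d1' d2' : measure_display)
    (T1 : measurableType d1) (T2 : measurableType d2)
    (T1' : measurableType d1') (T2' : measurableType d2')
    (P : probability T1 R) (Q : probability T2 R)
    (f : T1 -> T1') (mf : measurable_fun setT f)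
    (g : T2 -> T2') (mg : measurable_fun setT g) (A : set (T1' * T2')) :
  measurable A ->
  (push P mf \x push Q mg)%E A = (P \x Q)%E [set z | A (f z.1, g z.2)].
Proof.
move=> mA.
have mfg : measurable_fun setT (fun z : T1 * T2 => (f z.1, g z.2)).
  by apply: measurable_fun_pair; exact: measurableT_comp.
rewrite (product_measure_unique (m' := push (P \x Q)%E mfg))//= => B C mB mC.
have mfB : measurable (f @^-1` B) by rewrite -[X in measurable X]setTI; exact: mf.
have mgC : measurable (g @^-1` C) by rewrite -[X in measurable X]setTI; exact: mg.
exact: (product_measure1E P Q mfB mgC).
Qed.

Lemma product_measure_cross (R : realType) (d : measure_display)
    (T : measurableType d) (P : probability T R) (A : set (T * T)) (Q : set T)
    (e : R) : measurable A -> measurable Q -> (P Q <= e%:E)%E ->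
  (forall s t, A (s, t) -> Q s \/ Q t) -> ((P \x P) A <= (e + e)%:E)%E.
Proof.
move=> mA mQ Qe AQ.
have mQT : measurable (Q `*` [set: T]) by exact: measurableX.
have mTQ : measurable ([set: T] `*` Q) by exact: measurableX.
apply: (@le_trans _ _ ((P \x P) ((Q `*` setT) `|` (setT `*` Q)))%E).
  apply: le_measure; rewrite ?inE//; first exact: measurableU.
  by move=> [s t] /AQ[Qs|Qt]; [left|right].
apply: (@le_trans _ _ ((P \x P) (Q `*` setT) + (P \x P) (setT `*` Q))%E).
  exact: measureU2.
rewrite !product_measure1E// [X in (_ * X + _)%E]probability_setT.
by rewrite [X in (_ + X * _)%E]probability_setT mule1 mul1e EFinD leeD.
Qed.

(** * From parametrizations to couplings *)

Section unit_lebesgue.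
Context (R : realType).

Lemma measurable_unit_itv : measurable (@unit_itv R).
Proof. exact: measurable_itv. Qed.

(** A probability on the whole line carried by [0,1], because parametrizations are functions on the
    line. *)
Definition unit_lebesgue : set (measurableTypeR R) -> \bar R :=
  mrestr lebesgue_measure measurable_unit_itv.

HB.instance Definition _ := Measure.on unit_lebesgue.

Let unit_lebesgueT : unit_lebesgue setT = 1%E.
Proof.
rewrite /unit_lebesgue /mrestr setTI /unit_itv lebesgue_measure_itv/= lte_fin.
by rewrite ltr01 oppr0 adde0.
Qed.

HB.instance Definition _ :=
  Measure_isProbability.Build _ _ _ unit_lebesgue unit_lebesgueT.

End unit_lebesgue.

Section coupling_measurability.
Context (R : realType) (X Y : lmmspace R).

Lemma measurable_coupling_fst :
  measurable_fun setT (fst : borel (points X * points Y)%type -> borel (points X)).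
Proof. by apply: continuous_borel_measurable => -[x y]; exact: cvg_fst. Qed.

Lemma measurable_coupling_snd :
  measurable_fun setT (snd : borel (points X * points Y)%type -> borel (points Y)).
Proof. by apply: continuous_borel_measurable => -[x y]; exact: cvg_snd. Qed.

Lemma measurable_distortion_gt (e : R) :
  measurable [set p : borel (points X * points Y)%type *
                      borel (points X * points Y)%type |
    e < `|tau p.1.1 p.2.1 - tau p.1.2 p.2.2|].
Proof.
pose Z := borel (points X * points Y)%type.
have mX : measurable_fun setT (fun p : Z * Z => tau (p.1.1 : points X) p.2.1).
  have h : measurable_fun setT
      (fun p : Z * Z => (p.1.1 : borel (points X), p.2.1 : borel (points X))).
    by apply: measurable_fun_pair; exact: (measurableT_comp measurable_coupling_fst).
  exact: (measurableT_comp (measurable_tau (tauP X)) h).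
have mY : measurable_fun setT (fun p : Z * Z => tau (p.1.2 : points Y) p.2.2).
  have h : measurable_fun setT
      (fun p : Z * Z => (p.1.2 : borel (points Y), p.2.2 : borel (points Y))).
    by apply: measurable_fun_pair; exact: (measurableT_comp measurable_coupling_snd).
  exact: (measurableT_comp (measurable_tau (tauP Y)) h).
have /(_ measurableT `]e, +oo[%classic) :=
  measurableT_comp (@normr_measurable R setT) (measurable_funB mX mY).
rewrite setTI => /(_ (measurable_itv _)); congr measurable.
by apply/seteqP; split => p /=; rewrite in_itv/= andbT.
Qed.

Lemma parametrization_coupling psi psi' : @parametrization R X psi ->
  @parametrization R Y psi' ->
  exists F : measurableTypeR R -> borel (points X * points Y)%type,
  exists2 mF : measurable_fun setT F,
    {in @unit_itv R, forall t, F t = (psi t, psi' t)} &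
    coupling (push (@unit_lebesgue R) mF).
Proof.
move=> [mpsi lpsi] [mpsi' lpsi'].
have mU := @measurable_unit_itv R.
(* A parametrization is measurable only on [0,1]; replacing its outside values by a constant makes
   it measurable on the line. *)
have mX := iffLR (measurable_restrictT _ mU) mpsi.
have mY := iffLR (measurable_restrictT _ mU) mpsi'.
have [B [oB bB]] := second_countable_coarsest (tauP X).
have mF := measurable_pair_borel oB bB mX mY.
exists (fun t => ((psi \_ (@unit_itv R)) t, (psi' \_ (@unit_itv R)) t)), mF => [t tu|].
  by rewrite !patchE tu.
have pre (Z : pointedType) (phi : measurableTypeR R -> Z) (A : set Z) :
    (phi \_ (@unit_itv R)) @^-1` A `&` @unit_itv R = @unit_itv R `&` phi @^-1` A.
  apply/seteqP; split=> t /=.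
    by move=> [+ Ut]; rewrite patchE mem_set.
  by move=> [Ut At]; rewrite patchE mem_set.
split=> A mA.
  by rewrite -lpsi// -[in RHS]pre.
by rewrite -lpsi'// -[in RHS]pre.
Qed.

End coupling_measurability.

Lemma distortion_ge0 (R : realType) (X Y : lmmspace R) : (0 <= distortion X Y)%E.
Proof.
apply: le_ereal_inf_tmp => _ [pi _ <-]; apply: le_ereal_inf_tmp => _ [e [e0 _] <-].
by rewrite lee_fin ltW.
Qed.

Lemma distortion_le_box (R : realType) (X Y : lmmspace R) (e : R) :
  (box_distance X Y < (e / 2)%:E)%E -> (distortion X Y < e%:E)%E.
Proof.
move=> /ereal_inf_lt[_ [psi [psi' [Ppsi Ppsi' ->]]]].
move=> /ereal_inf_lt[_ [r [r0 [Q [mQ QU Qr Qd]]] <-]]; rewrite lte_fin => re.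
have [F [mF FE cF]] := parametrization_coupling Ppsi Ppsi'.
(* The two strips over the exceptional set have total mass up to [r + r], which accounts for the
   factor [2] between box and distortion distance. *)
apply: (@le_lt_trans _ _ (r + r)%:E); last first.
  by rewrite lte_fin (splitr e) ltrD.
apply: ge_ereal_inf; eexists; first by exists (push (@unit_lebesgue R) mF).
apply: ge_ereal_inf; exists (r + r)%:E => //.
exists (r + r) => //; split; first by rewrite addr_gt0.
have mD := @measurable_distortion_gt R X Y (r + r).
rewrite product_measure_push//.
(* Nothing is known about [F] outside [0,1], so the complement, a null set of [unit_lebesgue], joins
   the exceptional set. *)
apply: (@product_measure_cross _ _ _ _ _ (Q `|` ~` @unit_itv R)).
- have mFF : measurable_fun setT
      (fun z : measurableTypeR R * measurableTypeR R => (F z.1, F z.2)).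
    by apply: measurable_fun_pair; exact: (measurableT_comp mF).
  by rewrite -[X in measurable X]setTI; exact: mFF.
- by apply: measurableU => //; apply: measurableC; exact: measurable_unit_itv.
- apply: le_trans Qr; apply: (@le_trans _ _
    (lebesgue_measure ((Q `|` ~` @unit_itv R) `&` @unit_itv R))) => //.
  by rewrite setIUl setICl setU0 setIidl.
- move=> s t /=; apply: contraPP.
  move=> /not_orP[/not_orP[Qs /contrapT us] /not_orP[Qt /contrapT ut]].
  rewrite !FE ?inE//=; apply/negP; rewrite -leNgt.
  by apply: le_trans (Qd s t _ _) _ => //; rewrite lerDl ltW.
Qed.

(** * Laws of the random matrices *)

(** An open set of matrices is the union of the countably many boxes with rational centre and radius
    [1/(n+1)] that it contains, and preimages of boxes involve finitely many entries. *)
Lemma measurable_fun_matrix (R : realType) (d : measure_display)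
    (Z : measurableType d) (m n : nat) (F : Z -> 'M[R]_(m, n)) :
  (forall i j, measurable_fun setT (fun z => F z i j)) ->
  measurable_fun setT (F : Z -> borel 'M[R]_(m, n)).
Proof.
move=> mF; apply: (@measurability _ _ _ (borel 'M[R]_(m, n)) _ _
  (@open 'M[R]_(m, n))) => // _ [U oU <-]; rewrite setTI.
pose box (q : 'M[rat]_(m, n) * nat) : set 'M[R]_(m, n) :=
  [set A | forall i j, `|ratr (q.1 i j) - A i j| < q.2.+1%:R^-1].
pose G q : set Z := if `[< box q `<=` U >] then F @^-1` box q else set0.
have -> : F @^-1` U = \bigcup_q G q.
  apply/seteqP; split => [z Uz|z [q _]]; last first.
    by rewrite /G; case: asboolP => // qU; exact: qU.
  have /nbhs_ballP[r /= r0 rU] : nbhs (F z) U by exact: open_nbhs_nbhs.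
  have [k rk] : exists k : nat, k.+1%:R^-1 < r / 2.
    have /ltr_add_invr[k] : 0 < r / 2 by rewrite divr_gt0.
    by rewrite add0r => ?; exists k.
  have k0 : 0 < k.+1%:R^-1 :> R by rewrite invr_gt0.
  have /choice[q qP] (p : 'I_m * 'I_n) : exists q : rat,
      `|ratr q - F z p.1 p.2| < k.+1%:R^-1.
    have /rat_in_itvoo[q] : F z p.1 p.2 < F z p.1 p.2 + k.+1%:R^-1.
      by rewrite ltrDl.
    rewrite in_itv/= => /andP[q1 q2]; exists q.
    by rewrite ger0_norm ?subr_ge0 ?ltW// ltrBlDl.
  exists (\matrix_(i, j) q (i, j), k) => //; rewrite /G; case: asboolP => [_|].
    by move=> i j; rewrite mxE; exact: (qP (i, j)).
  case=> A Aq; apply: rU; split => // i j; rewrite /ball/=.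
  have := Aq i j; have := qP (i, j); rewrite /= mxE => q1 q2.
  rewrite (splitr r) -(subrKA (ratr (q (i, j)))); 
  apply: le_lt_trans (ler_normD _ _) _; apply: ltrD.
    by rewrite distrC (lt_trans q1).
  by rewrite (lt_trans q2).
apply: countable_bigcupT_measurable => // q; rewrite /G; case: ifP => // _.
have -> : F @^-1` box q = \bigcap_(p in [set: 'I_m * 'I_n])
    [set z | `|ratr (q.1 p.1 p.2) - F z p.1 p.2| < q.2.+1%:R^-1].
  by apply/seteqP; split=> [z h p _|z h i j]; [exact: h|exact: (h (i, j))].
apply: fin_bigcap_measurable => // p _.
have mf : measurable_fun setT (fun z => `|ratr (q.1 p.1 p.2) - F z p.1 p.2|).
  apply: measurableT_comp; first exact: normr_measurable.
  by apply: measurable_funB => //; exact: mF.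
have := mf measurableT _ (measurable_itv `]-oo, (q.2.+1%:R^-1)[).
by rewrite setTI; congr measurable; apply/seteqP; split => z /=; rewrite in_itv.
Qed.

Section matrix_law.
Context (R : realType) (X : lmmspace R) (k : nat).

Lemma measurable_tau_matrix : measurable_fun setT (@tau_matrix R X k).
Proof.
apply: measurable_fun_matrix => i j.
under eq_fun do rewrite mxE.
have h : measurable_fun setT
    (fun x : k.-tuple (borel (points X)) => (tnth x i, tnth x j)).
  by apply: measurable_fun_pair; exact: measurable_tnth.
exact: (measurableT_comp (measurable_tau (tauP X)) h).
Qed.

Definition matrix_prob : probability (borel 'M[R]_k) R :=
  push (mpower_prob (mm X) k) measurable_tau_matrix.

Lemma matrix_lawE : @matrix_law R X k = matrix_prob.
Proof. by rewrite /matrix_law mpower_probE. Qed.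

(** Applied to both projections of a coupling, this realises the two random matrices on a single
    probability space. *)
Lemma matrix_prob_coupled (d : measure_display) (Z : measurableType d)
    (pi : probability Z R) (p : Z -> borel (points X))
    (mp : measurable_fun setT p) :
  (forall A, measurable A -> pi (p @^-1` A) = mm X A) ->
  exists mF : measurable_fun setT (fun z : k.-tuple Z => tau_matrix (map_tuple p z)),
  forall A, measurable A -> push (mpower_prob pi k) mF A = matrix_prob A.
Proof.
move=> ppi.
have mF := measurableT_comp measurable_tau_matrix (measurable_map_tuple (k := k) mp).
exists mF => A mA.
have mtA : measurable (@tau_matrix R X k @^-1` A).
  by rewrite -[X in measurable X]setTI; exact: measurable_tau_matrix.
exact: (mpower_prob_map mp ppi mtA).
Qed.

End matrix_law.

Lemma probability_bigsetU_le (R : realType) (d : measure_display)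
    (T : measurableType d) (P : probability T R) (I : Type) (s : seq I)
    (A : I -> set T) (e : R) :
  (forall i, measurable (A i)) -> (forall i, (P (A i) <= e%:E)%E) ->
  (P (\big[setU/set0]_(i <- s) A i) <= ((size s)%:R * e)%:E)%E.
Proof.
move=> mA Ae; elim: s => [|i s IH]; first by rewrite big_nil measure0 mul0r.
rewrite big_cons /= -natr1 mulrDl mul1r addrC EFinD.
apply: le_trans (leeD (Ae i) IH); apply: measureU2 => //.
exact: bigsetU_measurable.
Qed.

(** * Probabilistic control of the modulus of continuity *)

Section modulus_failure.
Context (R : realType) (m n : nat) (f : 'M[R]_(m, n) -> R).
Hypothesis cf : continuous f.

(* Complement of the set on which [d] is a modulus of continuity of [f] for
   the error [h]. It is open and shrinks to the empty set as [d] tends to [0],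
   which replaces uniform continuity. *)
Definition modulus_failure (h d : R) : set 'M[R]_(m, n) :=
  [set B : 'M[R]_(m, n) | exists2 A : 'M[R]_(m, n),
    (forall i j, `|A i j - B i j| < d) & h < `|f A - f B|].

(** The witness [A] for [B] also serves all nearby matrices, as both strict inequalities are open
    conditions on [B]. *)
Lemma open_modulus_failure (h d : R) : open (modulus_failure h d).
Proof.
rewrite openE => B [A AB fAB]; rewrite /interior.
have n1 : nbhs B [set C : 'M[R]_(m, n) | forall i j, `|A i j - C i j| < d].
  exists (fun i j => [set y | `|A i j - y| < d]) => // i j.
  apply: open_nbhs_nbhs; split; last exact: AB.
  exact: (@ball_open R R (A i j) d).
have n2 : nbhs B [set C | h < `|f A - f C|].
  have FB : Filter (nbhs B) by exact: nbhs_filter.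
  have c1 : (fun C : 'M[R]_(m, n) => f A - f C) @ nbhs B --> f A - f B.
    by apply: cvgB; [exact: cvg_cst|exact: cf].
  have c2 : (fun C : 'M[R]_(m, n) => `|f A - f C|) @ nbhs B --> `|f A - f B|.
    exact: cvg_norm.
  exact: (@cvgr_gt _ _ _ FB _ _ c2 _ fAB).
by apply: filterS2 n1 n2 => C h1 h2; exists A.
Qed.

(** Continuity of [P] from above: the sets decrease with [d], and a common point would contradict
    continuity of [f] there. *)
Lemma modulus_failure_small (P : probability (borel 'M[R]_(m, n)) R) (h e : R) :
  0 < h -> 0 < e -> exists2 d, 0 < d & (P (modulus_failure h d) < e%:E)%E.
Proof.
move=> h0 e0; pose F k := modulus_failure h k.+1%:R^-1.
have mF k : measurable (F k : set (borel 'M[R]_(m, n))).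
  by apply: sub_sigma_algebra; exact: open_modulus_failure.
have F0 : \bigcap_k F k = set0.
  apply/seteqP; split=> // B FB.
  have : nbhs B [set A | `|f B - f A| < h].
    have cB : f @ nbhs B --> f B by exact: cf.
    have FB' : Filter (nbhs B) by exact: nbhs_filter.
    exact: (iffLR (@cvgrPdist_lt _ _ _ _ FB' _ _) cB).
  move=> /nbhs_ballP[r /= r0 rB].
  have [k rk] : exists k : nat, k.+1%:R^-1 < r.
    by have /ltr_add_invr[k] := r0; rewrite add0r => ?; exists k.
  have [A AB fAB] := FB k I.
  have : ball B r A.
    split => // i j; rewrite /ball/= distrC; exact: lt_trans (AB i j) rk.
  by move/rB => /=; rewrite distrC ltNge (ltW fAB).
have cF : (P \o F) x @[x --> \oo] --> P (\bigcap_k F k).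
  apply: nonincreasing_cvg_mu => //.
  - by rewrite (le_lt_trans (probability_le1 _ _))// ltry.
  - by rewrite F0.
  - move=> k l kl; apply/subsetPset => B [A AB fAB]; exists A => // i j.
    apply: lt_le_trans (AB i j) _.
    by rewrite lef_pV2 ?posrE// ler_nat ltnS.
rewrite F0 measure0 in cF.
have : \forall k \near \oo, ((P \o F) k < e%:E)%E.
  by apply: (cF [set x | (x < e%:E)%E]); apply: open_ereal_lt'; rewrite lte_fin.
move=> [k _ /(_ k (leqnn _))] Pk.
by exists k.+1%:R^-1; first by rewrite invr_gt0.
Qed.

End modulus_failure.

(** * Comparison of matrix laws along a coupling *)

(** Both integrals are rewritten over the [k]-th power of [pi]. The modulus failure is measured
    under the law of [Y], later the limit space, so that [d] can be chosen independently of the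
    approximating space. *)
Lemma coupled_matrix_integral (R : realType) (X Y : lmmspace R) (k : nat)
    (pi : probability (borel (points X * points Y)%type) R)
    (f : 'M[R]_k -> R) (C h d e : R) :
  coupling pi ->
  ((pi \x pi) [set p | (e < `|tau p.1.1 p.2.1 - tau p.1.2 p.2.2|)%R] <= e%:E)%E ->
  continuous f -> (forall A, `|f A| <= C) -> 0 <= e < d -> 0 <= h ->
  exists a b : R, [/\ (\int[@matrix_law R X k]_A (f A)%:E)%E = a%:E,
   (\int[@matrix_law R Y k]_A (f A)%:E)%E = b%:E &
   (`|a - b|%:E <= (h + 2 * C * ((k * k)%:R * e))%:E +
     (2 * C)%:E * matrix_prob Y k (modulus_failure f h d))%E].
Proof.
move=> [piX piY] pie cf fC /andP[e0 ed] h0.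
have C0 : 0 <= C by apply: le_trans (fC 0); exact: normr_ge0.
pose P := mpower_prob pi k.
have mf : measurable_fun setT (f : borel 'M[R]_k -> R).
  exact: continuous_real_measurable.
have [mFX FX] := @matrix_prob_coupled R X k _ _ pi _ (@measurable_coupling_fst R X Y) piX.
have [mFY FY] := @matrix_prob_coupled R Y k _ _ pi _ (@measurable_coupling_snd R X Y) piY.
set F := (fun z => _) in mFX FX; set G := (fun z => _) in mFY FY.
have bint (g : k.-tuple (borel (points X * points Y)%type) -> R) :
    measurable_fun setT g -> (forall z, `|g z| <= C) -> P.-integrable setT (EFin \o g).
  move=> mg gC; apply: measurable_bounded_integrable => //.
    by rewrite (le_lt_trans (probability_le1 _ _))// ltry.
  exists C; split; first exact: num_real.
  by move=> x Cx z _; apply: le_trans (gC z) _; exact: ltW.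
have mfF : measurable_fun setT (fun z => f (F z)) by exact: measurableT_comp mf mFX.
have mfG : measurable_fun setT (fun z => f (G z)) by exact: measurableT_comp mf mFY.
have iF := bint _ mfF (fun z => fC _).
have iG := bint _ mfG (fun z => fC _).
have EX : (\int[@matrix_law R X k]_A (f A)%:E = \int[P]_z (f (F z))%:E)%E.
  rewrite matrix_lawE -(eq_measure_integral _ (fun A mA _ => FX A mA)).
  rewrite integral_pushforward//; exact: measurableT_comp.
have EY : (\int[@matrix_law R Y k]_A (f A)%:E = \int[P]_z (f (G z))%:E)%E.
  rewrite matrix_lawE -(eq_measure_integral _ (fun A mA _ => FY A mA)).
  rewrite integral_pushforward//; exact: measurableT_comp.
exists (\int[P]_z (f (F z)))%R, (\int[P]_z (f (G z)))%R.
rewrite EX EY; split.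
- by rewrite fineK//; exact: integrable_fin_num.
- by rewrite fineK//; exact: integrable_fin_num.
pose E := [set p : borel (points X * points Y)%type * borel (points X * points Y)%type |
  (e < `|tau p.1.1 p.2.1 - tau p.1.2 p.2.2|)%R].
have mE : measurable E by exact: measurable_distortion_gt.
pose D (p : 'I_k * 'I_k) := [set z : k.-tuple (borel (points X * points Y)%type) |
  E (tnth z p.1, tnth z p.2)].
have mD p : measurable (D p).
  have h1 : measurable_fun setT (fun z : k.-tuple (borel (points X * points Y)%type) =>
      (tnth z p.1, tnth z p.2)).
    by apply: measurable_fun_pair; exact: measurable_tnth.
  by rewrite -[X in measurable X]setTI; exact: h1.
have PD p : (P (D p) <= e%:E)%E.
  case: p => i j; have [ij|ij] := eqVneq i j; last by rewrite mpower_prob_tnth2.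
  rewrite (_ : D _ = set0) ?measure0 ?lee_fin//.
  apply/seteqP; split=> // z; rewrite /D/E/= ij.
  rewrite (lorentzian_xx _ (tauP X)) (lorentzian_xx _ (tauP Y)).
  by rewrite subrr normr0 ltNge e0.
pose U := \big[setU/set0]_(p <- enum ({: 'I_k * 'I_k})) D p.
pose V := G @^-1` modulus_failure f h d.
have mU : measurable U by exact: bigsetU_measurable.
have mV : measurable V.
  rewrite -[X in measurable X]setTI; apply: (mFY measurableT).
  by apply: sub_sigma_algebra; exact: open_modulus_failure.
have PU : (P U <= ((k * k)%:R * e)%:E)%E.
  have := probability_bigsetU_le (enum ({: 'I_k * 'I_k})) mD PD.
  by rewrite -cardT card_prod card_ord.
have PV : P V = matrix_prob Y k (modulus_failure f h d).
  rewrite -FY//; by apply: sub_sigma_algebra; exact: open_modulus_failure.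
(* On the union of [U] and [V] the trivial bound [2 * C] applies. Off [U] the entries of [F z] and
   [G z] differ by at most [e < d], so a jump of [f] above [h] would make [F z] a witness that [z]
   lies in [V]. *)
have bnd z : `|f (F z) - f (G z)| <= h + 2 * C * \1_(U `|` V) z.
  have [UV|UV] := pselect ((U `|` V) z).
    rewrite indicE mem_set// mulr1 (le_trans (ler_normB _ _))//.
    by rewrite ler_wpDl// mulr_natl mulr2n lerD.
  rewrite indicE memNset// mulr0 addr0 leNgt; apply/negP => fh.
  apply: UV; have [Uz|nU] := pselect (U z); first by left.
  right; exists (F z) => // i j; apply: le_lt_trans ed.
  rewrite /F /G !mxE !tnth_map leNgt; apply/negP => lte; apply: nU.
  by rewrite /U -bigcup_seq; exists (i, j) => //=; rewrite mem_enum.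
rewrite -RintegralB// EFin_normr_Rintegral//; last first.
  have := integrableB measurableT iF iG; apply: eq_integrable => //.
apply: (@le_trans _ _ (\int[P]_z (h%:E + (2 * C)%:E * (\1_(U `|` V) z)%:E))%E).
  apply: le_trans (le_abse_integral _ _ _) _ => //.
    by apply/measurable_EFinP; exact: measurable_funB.
  apply: ge0_le_integral => //.
  - by apply: measurableT_comp => //; apply/measurable_EFinP; exact: measurable_funB.
  - apply: emeasurable_funD => //; apply: emeasurable_funM => //.
    by apply/measurable_EFinP; apply: measurable_indic; exact: measurableU.
  - by move=> z _; rewrite -EFinM -EFinD abse_EFin lee_fin.
have mUV : measurable (U `|` V) by exact: measurableU.
rewrite ge0_integralD//; last 2 first.
- by move=> z _; rewrite mule_ge0// lee_fin ?mulr_ge0.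
- apply: emeasurable_funM => //.
  by apply/measurable_EFinP; exact: measurable_indic.
rewrite integral_cst// [X in (_ * X + _)%E]probability_setT mule1.
rewrite ge0_integralZl_EFin ?mulr_ge0//; last first.
  by apply/measurable_EFinP; exact: measurable_indic.
rewrite integral_indic// setIT EFinD -addeA leeD2l// -PV.
rewrite (EFinM (2 * C)) -ge0_muleDr ?lee_fin ?mulr_ge0//.
rewrite lee_wpmul2l ?lee_fin ?mulr_ge0//.
apply: le_trans (measureU2 _ mU mV) _; exact: leeD.
Qed.

Lemma distortion_lt_coupling (R : realType) (X Y : lmmspace R) (e : R) :
  (distortion X Y < e%:E)%E -> exists2 pi, coupling (X := X) (Y := Y) pi &
    exists2 r : R, 0 < r < e &
    ((pi \x pi) [set p | (r < `|tau p.1.1 p.2.1 - tau p.1.2 p.2.2|)%R] <= r%:E)%E.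
Proof.
move=> /ereal_inf_lt[_ [pi cpi <-]] /ereal_inf_lt[_ [r [r0 pir] <-]].
by rewrite lte_fin => re; exists pi => //; exists r => //; rewrite r0.
Qed.

(** * The two convergence implications *)

Lemma box_distortion_cvg (R : realType) (X_ : nat -> lmmspace R) (X : lmmspace R) :
  box_distance (X_ n) X @[n --> \oo] --> 0%E ->
  distortion (X_ n) X @[n --> \oo] --> 0%E.
Proof.
move=> boxc.
have near_dist (e : R) : 0 < e -> \forall n \near \oo, (distortion (X_ n) X < e%:E)%E.
  move=> e0; have : \forall n \near \oo, (box_distance (X_ n) X < (e / 2)%:E)%E.
    apply: (boxc [set x | (x < (e / 2)%:E)%E]); apply: open_ereal_lt'.
    by rewrite lte_fin divr_gt0.
  by apply: filterS => n; exact: distortion_le_box.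
(* Convergence in the extended reals is reduced to real convergence, which needs eventually finite
   values; the threshold [1] is arbitrary. *)
have fin n : (distortion (X_ n) X < 1%:E)%E -> distortion (X_ n) X \is a fin_num.
  by move=> d1; rewrite ge0_fin_numE ?distortion_ge0// (lt_trans d1)// ltry.
apply/fine_cvgP; split; first by apply: filterS (near_dist 1 ltr01) => n; exact: fin.
apply/cvgrPdist_lt => e e0; apply: filterS2 (near_dist 1 ltr01) (near_dist _ e0).
move=> n /fin dfin de; rewrite sub0r normrN /= ger0_norm ?fine_ge0 ?distortion_ge0//.
by rewrite -lte_fin fineK.
Qed.

Lemma distortion_intrinsic_cvg (R : realType) (X_ : nat -> lmmspace R) (X : lmmspace R) :
  distortion (X_ n) X @[n --> \oo] --> 0%E -> intrinsic_cvg X_ X.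
Proof.
move=> distc k f cf [M [_ fM]].
(* Boundedness provides a bound by every real strictly above [M]; this choice is also positive. *)
pose C := `|M| + 1.
have C0 : 0 < C by rewrite ltr_wpDl.
have fC A : `|f A| <= C.
  by apply: fM => //; rewrite (le_lt_trans (ler_norm M))// ltrDl.
have fin (Y : lmmspace R) : (\int[@matrix_law R Y k]_A (f A)%:E)%E \is a fin_num.
  rewrite matrix_lawE; apply: integrable_fin_num => //.
  apply: measurable_bounded_integrable => //.
  - by rewrite (le_lt_trans (probability_le1 _ _))// ltry.
  - exact: continuous_real_measurable.
  - by exists C; split; [exact: num_real|move=> x Cx z _; exact: le_trans (ltW Cx)].
rewrite -(fineK (fin X)); apply/fine_cvgP; split.
  by apply: nearW => n; exact: fin.
apply/cvgrPdist_lt => eps eps0 /=.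
(* Three errors get [eps / 4] each: the oscillation [h], the modulus failure weighted by [2 * C],
   and the distortion term [2 * C * k^2 * r]. *)
have q0 : 0 < eps / 4 by rewrite divr_gt0.
have C20 : 0 < 2 * C by rewrite mulr_gt0.
have [d d0 Pd] := modulus_failure_small cf (matrix_prob X k) q0 (divr_gt0 q0 C20).
(* The summand [1] keeps [K] positive for [k = 0]. *)
pose K : R := 2 * C * ((k * k)%:R + 1).
have K0 : 0 < K by rewrite mulr_gt0// ltr_wpDl.
pose e := Num.min d (eps / 4 / K).
have e0 : 0 < e by rewrite lt_min d0 divr_gt0.
have : \forall n \near \oo, (distortion (X_ n) X < e%:E)%E.
  apply: (distc [set x | (x < e%:E)%E]); apply: open_ereal_lt'.
  by rewrite lte_fin.
apply: filterS => n /distortion_lt_coupling[pi cpi [r /andP[r0]]].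
rewrite lt_min => /andP[rd rK] pir.
have rd' : 0 <= r < d by rewrite ltW.
have [a [b [-> -> ab]]] := coupled_matrix_integral cpi pir cf fC rd' (ltW q0).
rewrite /= distrC -lte_fin; apply: le_lt_trans ab _.
have mb : measurable (modulus_failure f (eps / 4) d : set (borel 'M[R]_k)).
  by apply: sub_sigma_algebra; exact: open_modulus_failure.
rewrite -(fineK (fin_num_measure (matrix_prob X k) _ mb)) in Pd *.
set p := fine _ in Pd *; rewrite -EFinM -EFinD lte_fin.
rewrite lte_fin ltr_pdivlMr// in Pd; rewrite ltr_pdivlMr// in rK.
have : 2 * C * ((k * k)%:R * r) <= r * K.
  by rewrite mulrA [leRHS]mulrC ler_wpM2r ?(ltW r0)// ler_pM2l// lerDl.
lra.
Qed.

Theorem theorem1p4 (R : realType) (X_ : nat -> lmmspace R) (X : lmmspace R) :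
  (box_distance (X_ n) X @[n --> \oo] --> 0%E ->
   distortion (X_ n) X @[n --> \oo] --> 0%E) /\
  (distortion (X_ n) X @[n --> \oo] --> 0%E ->
   intrinsic_cvg X_ X).
Proof.
by split; [exact: box_distortion_cvg|exact: distortion_intrinsic_cvg].
Qed.
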